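(* Let $(\Omega,\Sigma,\mu)$ be a $\sigma$-finite measure space and let $K\subset L^1(\mu)$ be nonempty, bounded, closed, convex and measure-compact. Let $T:K\to K$ be nonexpansive. Let $H:K\to K$ be of the form $H(f)=\psi\circ f$, where $\psi:\mathbb R\to\mathbb R$ is $1$-Lipschitz and idempotent ($\psi\circ\psi=\psi$). Let $\mathcal G\subset\Sigma$ be a finite sub-$\sigma$-algebra and let $Q:=\mathbb E[\cdot\mid\mathcal G]$, assumed to map $K$ into $K$. Then the composite $\Phi:=Q\circ H\circ T:K\to K$ admits a fixed point in $Q(K)$, i.e. there exists $f^\star\in Q(K)$ with $\Phi(f^\star)=f^\star$. (Consequently the iteration $f_{n+1}=\Phi(f_n)$ possesses a stationary point.)
   Context: ''Bounded'' and ''closed'' refer to the norm $\|\cdot\|_1$ of $L^1(\mu)$. A set $K\subset L^1(\mu)$ is measure-compact if it is compact with respect to the topology of local convergence in measure, i.e. the topology in which $f_n\to f$ means $f_n\to f$ in measure on every measurable subset of $\Omega$ of finite measure. A map $S:K\to K$ is nonexpansive if $\|S(f)-S(g)\|_1\le\|f-g\|_1$ for all $f,g\in K$. $\mathbb E[f\mid\mathcal G]$ denotes the conditional expectation of $f\in L^1(\mu)$ with respect to $\mathcal G$, i.e. the integrable $\mathcal G$-measurable function with $\int_B\mathbb E[f\mid\mathcal G]\,d\mu=\int_B f\,d\mu$ for all $B\in\mathcal G$. *)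

(* Defs.v *)
(* MathComp-Analysis *)
From HB Require Import structures.
From mathcomp Require Import all_boot all_order all_algebra.
From mathcomp Require Import all_classical all_reals all_analysis.
From mathcomp Require Import generic_quotient measurable_realfun.

Set Implicit Arguments.
Unset Strict Implicit.
Unset Printing Implicit Defensive.

Import Order.TTheory GRing.Theory Num.Theory.
Import numFieldNormedType.Exports.

Local Open Scope classical_set_scope.
Local Open Scope ring_scope.
Local Open Scope quotient_scope.

(* [LspaceType1 mu] is the library's type of a.e.-equality classes of
   integrable real functions; it comes without algebra or norm. Its elements
   coerce to functions through a chosen representative. *)
Section L1_classes.
Context d (T : measurableType d) (R : realType).
Variable mu : {measure set T -> \bar R}.
Local Notation L1 := (LspaceType1 mu).

Lemma L1_measurable (f : L1) : measurable_fun [set: T] (f : T -> R).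
Proof. exact: (@measurable_funPT _ _ T (measurableTypeR R) (repr (LebesgueSpace.sort f))). Qed.

Lemma L1_integrable (f : L1) : mu.-integrable [set: T] (EFin \o (f : T -> R)).
Proof.
apply/integrableP; split; first by apply/measurable_EFinP; exact: L1_measurable.
by have := @Lebesgue_finite _ _ _ _ _ _ f; rewrite /finite_norm Lnorm1.
Qed.

Lemma L1_eqP (f g : L1) : (f : T -> R) = g %[ae mu] <-> f = g.
Proof.
split => [fg|->]; last exact: (ae_eq_refl mu setT).
case: f g fg => f [[pf]] [g [[pg]]] /= fg.
have fgE : f = g.
  by rewrite -[f]reprK -[g]reprK; apply/eqP; rewrite eqmodE; apply/asboolP.
by move: pf; rewrite fgE => pf; rewrite (Prop_irrelevance pf pg).
Qed.

Section toL1.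
Variables (f : T -> R) (intf : mu.-integrable [set: T] (EFin \o f)).

Let mf : measurable_fun [set: T] (f : T -> measurableTypeR R).
Proof. by have /integrableP[/measurable_EFinP] := intf. Qed.

Let fM : {mfun T >-> measurableTypeR R} :=
  @mfun_Sub _ _ T (measurableTypeR R) f (mem_set mf).

Let cl : {mfun_ mu, T >-> measurableTypeR R} :=
  \pi_{mfun_ mu, T >-> measurableTypeR R} fM.

Let cl_ae : (cl : T -> R) = f %[ae mu].
Proof.
by apply/asboolP; have /eqP := reprK cl; rewrite eqmodE.
Qed.

Let cl_fin : finite_norm mu 1%E (cl : T -> R).
Proof.
have mcl : measurable_fun [set: T] (cl : T -> R).
  exact: (@measurable_funPT _ _ T (measurableTypeR R) (repr cl)).
rewrite /finite_norm Lnorm1.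
have /integrableP[_] := intf; congr (_ < _)%E; apply: ae_eq_integral => //.
- by apply: measurableT_comp => //; apply/measurable_EFinP.
- by apply: measurableT_comp => //; apply/measurable_EFinP.
- by apply: filterS cl_ae => x /= /[apply] ->.
Qed.

Definition toL1 : L1 :=
  LebesgueSpace.Pack (LebesgueSpace.Class 
    (@isFinLebesgue.Axioms_ _ T R mu 1%E (lexx _) cl cl_fin)).

Lemma toL1E : (toL1 : T -> R) = f %[ae mu].
Proof. exact: cl_ae. Qed.

End toL1.

Lemma L1_integrableD (f g : L1) :
  mu.-integrable [set: T] (EFin \o (fun x => f x + g x : R)).
Proof.
exact: (integrableD measurableT (L1_integrable f) (L1_integrable g)).
Qed.

Lemma L1_integrableZ (a : R) (f : L1) :
  mu.-integrable [set: T] (EFin \o (fun x => a * f x : R)).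
Proof.
exact: (integrableZl measurableT a (L1_integrable f)).
Qed.

Definition L1_zero : L1 := @toL1 (cst 0) (integrable0 mu [set: T]).
Definition L1_add (f g : L1) : L1 := toL1 (L1_integrableD f g).
Definition L1_scale (a : R) (f : L1) : L1 := toL1 (L1_integrableZ a f).
Definition L1_opp (f : L1) : L1 := L1_scale (-1) f.

Lemma L1_zeroE : (L1_zero : T -> R) = cst 0 %[ae mu].
Proof. exact: toL1E. Qed.

Lemma L1_addE f g : (L1_add f g : T -> R) = (fun x => f x + g x) %[ae mu].
Proof. exact: toL1E. Qed.

Lemma L1_scaleE a f : (L1_scale a f : T -> R) = (fun x => a * f x) %[ae mu].
Proof. exact: toL1E. Qed.

Lemma L1_addA : associative L1_add.
Proof.
move=> f g h; apply/L1_eqP.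
near=> x => _.
rewrite (near (L1_addE f (L1_add g h)) x)// (near (L1_addE g h) x)//.
rewrite (near (L1_addE (L1_add f g) h) x)// (near (L1_addE f g) x)//.
exact: addrA.
Unshelve. all: by end_near. Qed.

Lemma L1_addC : commutative L1_add.
Proof.
move=> f g; apply/L1_eqP; near=> x => _.
rewrite (near (L1_addE f g) x)// (near (L1_addE g f) x)//.
exact: addrC.
Unshelve. all: by end_near. Qed.

Lemma L1_add0 : left_id L1_zero L1_add.
Proof.
move=> f; apply/L1_eqP; near=> x => _.
rewrite (near (L1_addE L1_zero f) x)// (near L1_zeroE x)//.
exact: add0r.
Unshelve. all: by end_near. Qed.

Lemma L1_addN : left_inverse L1_zero L1_opp L1_add.
Proof.
move=> f; apply/L1_eqP; near=> x => _.
rewrite (near (L1_addE (L1_opp f) f) x)// (near (L1_scaleE (-1) f) x)//.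
by rewrite (near L1_zeroE x)// mulN1r addNr.
Unshelve. all: by end_near. Qed.

HB.instance Definition _ := gen_eqMixin (LspaceType1 mu).
HB.instance Definition _ := gen_choiceMixin (LspaceType1 mu).
HB.instance Definition _ := GRing.isZmodule.Build (LspaceType1 mu)
  L1_addA L1_addC L1_add0 L1_addN.

Lemma L1_scaleA a b f : L1_scale a (L1_scale b f) = L1_scale (a * b) f.
Proof.
apply/L1_eqP; near=> x => _.
rewrite (near (L1_scaleE a (L1_scale b f)) x)// (near (L1_scaleE b f) x)//.
rewrite (near (L1_scaleE (a * b) f) x)//.
exact: mulrA.
Unshelve. all: by end_near. Qed.

Lemma L1_scale1 : left_id 1 L1_scale.
Proof.
move=> f; apply/L1_eqP; near=> x => _.
by rewrite (near (L1_scaleE 1 f) x)// mul1r.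
Unshelve. all: by end_near. Qed.

Lemma L1_scaleDr : right_distributive L1_scale +%R.
Proof.
move=> a f g; apply/L1_eqP; near=> x => _.
rewrite (near (L1_scaleE a (L1_add f g)) x)// (near (L1_addE f g) x)//.
rewrite (near (L1_addE (L1_scale a f) (L1_scale a g)) x)//.
rewrite (near (L1_scaleE a f) x)// (near (L1_scaleE a g) x)//.
exact: mulrDr.
Unshelve. all: by end_near. Qed.

Lemma L1_scaleDl f : {morph L1_scale^~ f : a b / a + b}.
Proof.
move=> a b; apply/L1_eqP; near=> x => _.
rewrite (near (L1_scaleE (a + b) f) x)//.
rewrite (near (L1_addE (L1_scale a f) (L1_scale b f)) x)//.
rewrite (near (L1_scaleE a f) x)// (near (L1_scaleE b f) x)//.
exact: mulrDl.
Unshelve. all: by end_near. Qed.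

HB.instance Definition _ := GRing.Zmodule_isLmodule.Build R (LspaceType1 mu)
  L1_scaleA L1_scale1 L1_scaleDr L1_scaleDl.

Definition L1_norm (f : L1) : R := fine 'N[mu]_1[EFin \o (f : T -> R)]%E.

Lemma L1_normE f : (L1_norm f)%:E = (\int[mu]_x `|(f x)%:E|)%E.
Proof.
rewrite /L1_norm fineK ?Lnorm1// ge0_fin_numE ?integral_ge0//.
by have /integrableP[] := L1_integrable f.
Qed.

Let mabs (f : L1) : measurable_fun [set: T] (fun x => `|(f x)%:E|%E).
Proof.
by apply: measurableT_comp => //; apply/measurable_EFinP; exact: L1_measurable.
Qed.

Lemma L1_ler_normD f g : L1_norm (f + g) <= L1_norm f + L1_norm g.
Proof.
rewrite -lee_fin EFinD !L1_normE -ge0_integralD//.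
apply: ae_ge0_le_integral => //; first by move=> x _; exact: adde_ge0.
  by apply: emeasurable_funD.
apply: filterS (L1_addE f g) => x /(_ I) fgE _.
by rewrite [X in `|X%:E|%E]fgE EFinD lee_abs_add.
Qed.

Lemma L1_normrZ (a : R) f : L1_norm (a *: f) = `|a| * L1_norm f.
Proof.
apply: EFin_inj; rewrite EFinM !L1_normE -ge0_integralZl//.
apply: ae_eq_integral => //; first exact: measurable_funeM.
apply: filterS (L1_scaleE a f) => x /(_ I) afE _.
by rewrite [X in `|X%:E|%E]afE EFinM abseM.
Qed.

Lemma L1_normr0_eq0 f : L1_norm f = 0 -> f = 0.
Proof.
move=> nf0; have := L1_normE f; rewrite nf0 => /esym f0; apply/L1_eqP.
have mf : measurable_fun [set: T] (EFin \o (f : T -> R)).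
  by apply/measurable_EFinP; exact: L1_measurable.
have f0' := (ae_eq_integral_abs mu measurableT mf).1 f0.
near=> x => _; rewrite (near L1_zeroE x)//.
by apply: EFin_inj; exact: (near f0' x).
Unshelve. all: by end_near. Qed.

HB.instance Definition _ := Lmodule_isNormed.Build R (LspaceType1 mu)
  L1_ler_normD L1_normrZ L1_normr0_eq0.

Lemma L1_normrE (f : L1) : (`|f| : R)%:E = (\int[mu]_x `|(f x)%:E|)%E.
Proof. exact: L1_normE. Qed.

End L1_classes.


(* L^1 with the topology of local convergence in measure instead of the norm
   topology. The basic entourages are the sets of pairs (f, g) with
   mu (A `&` {|f - g| >= e}) < r, for A of finite measure and e, r > 0. *)
Definition L1_in_measure d (T : measurableType d) (R : realType)
  (mu : {measure set T -> \bar R}) : Type := LspaceType1 mu.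

Section local_convergence_in_measure.
Context d (T : measurableType d) (R : realType).
Variable mu : {measure set T -> \bar R}.
Local Notation L1 := (LspaceType1 mu).
Local Notation L1m := (L1_in_measure mu).

HB.instance Definition _ := Choice.copy L1m L1.

Definition dev_set (f g : L1) (e : R) : set T := [set x | e <= `|f x - g x|].

Definition in_measure_ent : set_system (L1m * L1m) :=
  [set E | exists (A : set T) (e r : R),
    [/\ measurable A, (mu A < +oo)%E, 0 < e, 0 < r &
        [set fg | (mu (A `&` dev_set fg.1 fg.2 e) < r%:E)%E] `<=` E]].

Lemma measurable_dev_set f g e : measurable (dev_set f g e).
Proof.
have mfg : measurable_fun [set: T] (fun x => `|f x - g x| : R).
  apply: measurableT_comp => //.
  by apply: measurable_funB; exact: L1_measurable.
have := mfg measurableT `[e, +oo[%classic (measurable_itv _).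
rewrite setTI; congr measurable; apply/seteqP.
by split => x; rewrite /dev_set /= in_itv/= andbT.
Qed.

Lemma dev_setC f g e : dev_set f g e = dev_set g f e.
Proof. by apply/seteqP; split => x; rewrite /dev_set /= distrC. Qed.

Lemma dev_set_split f g h e :
  dev_set f h e `<=` dev_set f g (e / 2) `|` dev_set g h (e / 2).
Proof.
move=> x; rewrite /dev_set /= => efh.
have [?|fge] := leP (e / 2) `|f x - g x|; [by left|right].
rewrite leNgt; apply/negP => ghe; move: efh; rewrite leNgt => /negP; apply.
rewrite [e]splitr -(subrKA (g x)).
by rewrite (le_lt_trans (ler_normD _ _))// ltrD.
Qed.

Lemma in_measure_ent_filter : Filter in_measure_ent.
Proof.
split.
- by exists set0, 1, 1; split => //; rewrite measure0.
- move=> P Q [A [e [r [mA Aoo e0 r0 AP]]]] [B [e' [r' [mB Boo e'0 r'0 BQ]]]].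
  exists (A `|` B), (Num.min e e'), (Num.min r r'); split => //.
  + exact: measurableU.
  + by rewrite (le_lt_trans (measureU2 mu mA mB))// lte_add_pinfty.
  + by rewrite lt_min e0.
  + by rewrite lt_min r0.
  move=> [f g] /= fg; split.
  + apply: AP => /=; apply: le_lt_trans (lt_le_trans fg _); last first.
      by rewrite lee_fin ge_min lexx.
    apply: le_measure; rewrite ?inE.
    * by apply: measurableI => //; exact: measurable_dev_set.
    * by apply: measurableI; [exact: measurableU|exact: measurable_dev_set].
    apply: setISS; first exact: subsetUl.
    by move=> x; apply: le_trans; rewrite ge_min lexx.
  + apply: BQ => /=; apply: le_lt_trans (lt_le_trans fg _); last first.
      by rewrite lee_fin ge_min lexx orbT.
    apply: le_measure; rewrite ?inE.
    * by apply: measurableI => //; exact: measurable_dev_set.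
    * by apply: measurableI; [exact: measurableU|exact: measurable_dev_set].
    apply: setISS; first exact: subsetUr.
    by move=> x; apply: le_trans; rewrite ge_min lexx orbT.
- move=> P Q PQ [A [e [r [mA Aoo e0 r0 AP]]]].
  by exists A, e, r; split => //; exact: subset_trans AP PQ.
Qed.

Lemma in_measure_ent_diagonal E : in_measure_ent E -> diagonal `<=` E.
Proof.
move=> [A [e [r [mA Aoo e0 r0 AE]]]] [f g]; rewrite /diagonal /= => <-.
apply: AE => /=; rewrite (_ : _ `&` _ = set0) ?measure0//.
by apply/seteqP; split => // x [_]; rewrite /dev_set /= subrr normr0 leNgt e0.
Qed.

Lemma in_measure_ent_inv E : in_measure_ent E -> in_measure_ent E^-1%relation.
Proof.
move=> [A [e [r [mA Aoo e0 r0 AE]]]]; exists A, e, r; split => //.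
by move=> [f g] /=; rewrite dev_setC => fg; exact: (AE (g, f)).
Qed.

Lemma in_measure_ent_split E : in_measure_ent E ->
  exists2 E', in_measure_ent E' & (E' \; E' `<=` E)%relation.
Proof.
move=> [A [e [r [mA Aoo e0 r0 AE]]]].
exists [set fg | (mu (A `&` dev_set fg.1 fg.2 (e / 2)) < (r / 2)%:E)%E].
  by exists A, (e / 2), (r / 2); split; rewrite ?divr_gt0.
move=> [f h] [g /= fg gh]; apply: AE => /=.
have mI u v : measurable (A `&` dev_set u v (e / 2)).
  by apply: measurableI => //; exact: measurable_dev_set.
rewrite [r]splitr EFinD; apply: le_lt_trans (lteD fg gh).
apply: le_trans (measureU2 mu (mI _ _) (mI _ _)).
apply: le_measure; rewrite ?inE.
- by apply: measurableI => //; exact: measurable_dev_set.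
- exact: measurableU.
by rewrite -setIUr; apply: setIS; exact: dev_set_split.
Qed.

HB.instance Definition _ := isUniform.Build L1m in_measure_ent_filter
  in_measure_ent_diagonal in_measure_ent_inv in_measure_ent_split.

Lemma cvg_in_measureP (F : set_system L1m) (f : L1m) : Filter F ->
  F --> f <->
  forall A (e : R), measurable A -> (mu A < +oo)%E -> 0 < e ->
    mu (A `&` dev_set f g e) @[g --> F] --> 0%E.
Proof.
move=> FF; split => [/cvg_entourageP Ff A e mA Aoo e0|Ff].
  have fin g : mu (A `&` dev_set f g e) \is a fin_num.
    rewrite ge0_fin_numE//; apply: le_lt_trans Aoo; apply: le_measure.
    - by rewrite inE; apply: measurableI => //; exact: measurable_dev_set.
    - by rewrite inE.
    - exact: subIsetl.
  apply/fine_cvgP; split; first by apply: nearW => g; exact: fin.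
  apply/cvgrPdist_lt => r r0.
  have : in_measure_ent
      [set fg | (mu (A `&` dev_set fg.1 fg.2 e) < r%:E)%E].
    by exists A, e, r; split.
  move=> /Ff; apply: filterS => g /= fgr.
  rewrite sub0r normrN ger0_norm ?fine_ge0//.
  by rewrite -lte_fin fineK.
apply/cvg_entourageP => E [A [e [r [mA Aoo e0 r0 AE]]]].
have /fine_cvgP[fin /cvgrPdist_lt/(_ r r0)] := Ff A e mA Aoo e0.
move=> fgr; near=> g; apply: AE => /=.
rewrite -[mu _]fineK; last by near: g.
rewrite lte_fin; apply: le_lt_trans (ler_norm _) _.
by rewrite -normrN -sub0r; near: g.
Unshelve. all: by end_near. Qed.

Definition measure_compact (K : set L1) : Prop := compact (K : set L1m).

End local_convergence_in_measure.

(* G-measurability of the class g means that some representative of it is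
   G-measurable. *)
Definition is_cond_exp d (T : measurableType d) (R : realType)
    (mu : {measure set T -> \bar R}) (G : set (set T))
    (f g : LspaceType1 mu) : Prop :=
  (exists2 h : T -> R,
     measurable_fun [set: g_sigma_algebraType G]
       (h : g_sigma_algebraType G -> R) &
     (g : T -> R) = h %[ae mu]) /\
  (forall B, G B ->
     (\int[mu]_(x in B) (g x)%:E = \int[mu]_(x in B) (f x)%:E)%E).

(* Main.v *)
(* [Q] maps [K] into the [G]-measurable elements of [K]; since [G] is finite,
   these are bounded combinations of the indicators of the atoms of [G], so they
   lie in a compact convex set [C] of [K] (for the norm). Each of [T], [H], [Q]
   is nonexpansive, hence so is [Q \o H \o T], which maps [C] into itself.
   A nonexpansive self-map [F] of a compact convex set has a fixed point: the
   displacement [`|F x - x|] attains its minimum, and this minimum is 0 because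
   the contractions [t *: c + (1 - t) *: F x] have fixed points. *)
Require Import Defs.
From mathcomp Require Import all_boot all_order all_algebra.
From mathcomp Require Import all_classical all_reals all_analysis.
From mathcomp Require Import measurable_realfun lra.

Set Implicit Arguments.
Unset Strict Implicit.
Import Order.TTheory GRing.Theory Num.Theory.
Import numFieldNormedType.Exports.

Local Open Scope classical_set_scope.
Local Open Scope ring_scope.

(** * Nonexpansive self-maps of compact sets *)

Section nonexpansive_maps_on_compact_sets.
Context (R : realType) (V : normedModType R) (C : set V).
Hypotheses (C0 : C !=set0) (cC : compact C).

(** A nonexpansive map is continuous on [C], hence so is its displacement, and the extreme value
    theorem applies. *)
Lemma compact_min_displacement (F : V -> V) :
  (forall x y, C x -> C y -> `|F x - F y| <= `|x - y|) ->
  exists2 c, C c & forall x, C x -> `|F c - c| <= `|F x - x|.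
Proof.
move=> Fne.
have [|c cC' cmin] := @compact_EVT_min _ R (fun x => `|F x - x|) C C0 cC;
  last first.
  by exists c; [exact: set_mem|move=> x Cx; apply: cmin; exact: mem_set].
apply/subspace_continuousP => x Cx; apply: cvg_norm; apply: cvgB; last first.
  exact: cvg_within_filter cvg_id.
apply/cvgrPdist_le => e e0.
have xe : \forall y \near nbhs x, `|x - y| <= e.
  by move/cvgrPdist_le : (@cvg_id _ (nbhs x)); exact.
near=> y.
have Cy : C y by near: y; exact: withinT.
apply: le_trans (Fne _ _ Cx Cy) _; near: y.
exact: cvg_within xe.
Unshelve. all: by end_near. Qed.

(* The displacement of [F] at [F c] is at most [k] times the one at [c]; take
   for [c] a point of minimal displacement. *)
Lemma compact_contraction_fixpoint (F : V -> V) (k : R) :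
  k < 1 -> (forall x, C x -> C (F x)) ->
  (forall x y, C x -> C y -> `|F x - F y| <= k * `|x - y|) ->
  exists2 x, C x & F x = x.
Proof.
move=> k1 FC Fk.
have [x y Cx Cy|c Cc cmin] := @compact_min_displacement F.
  by rewrite (le_trans (Fk _ _ Cx Cy))// ler_piMl// ltW.
exists c => //; apply/eqP; rewrite -subr_eq0 -normr_eq0.
have := le_trans (cmin _ (FC _ Cc)) (Fk _ _ (FC _ Cc) Cc).
have := normr_ge0 (F c - c); nra.
Qed.

Lemma compact_convex_nonexpansive_fixpoint (F : V -> V) :
  convex_set C -> (forall x, C x -> C (F x)) ->
  (forall x y, C x -> C y -> `|F x - F y| <= `|x - y|) ->
  exists2 x, C x & F x = x.
Proof.
move=> cvxC FC Fne; have [c Cc cmin] := compact_min_displacement Fne.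
exists c => //; apply/eqP; rewrite -subr_eq0 -normr_eq0 eq_le normr_ge0 andbT.
have [M [_ /(_ (M + 1))]] := compact_bounded cC.
rewrite ltrDl ltr01 => /(_ isT) CM.
have {}CM x : C x -> `|x| <= M + 1 by move=> /CM.
apply/ler_addgt0Pr => e e0; rewrite add0r.
(* The denominator is a positive bound for the norm of [F x - c] on [C], so [t] times that norm is
   at most [e]; the minimum with 1 keeps [t] a convex weight. *)
set t := Num.min 1 (e / (2 * (`|M + 1| + 1))).
have t0 : 0 < t by rewrite lt_min ltr01 divr_gt0// mulr_gt0// ltr_wpDl.
have t1 : t <= 1 by rewrite ge_min lexx.
pose Ft x := t *: c + (1 - t) *: F x.
have [||x y Cx Cy|x Cx Fx] := @compact_contraction_fixpoint Ft (1 - t).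
- by lra.
- move=> x Cx; apply: set_mem.
  exact: (cvxC c (F x) (Itv01 (ltW t0) t1) (mem_set Cc) (mem_set (FC _ Cx))).
- rewrite /Ft opprD addrACA subrr add0r -scalerBr normrZ ger0_norm ?subr_ge0//.
  by rewrite ler_wpM2l ?subr_ge0// Fne.
apply: (le_trans (cmin _ Cx)).
(* Solving [Ft x = x] for the displacement leaves the factor [t], which makes it small. *)
have -> : F x - x = t *: (F x - c).
  by rewrite -{2}Fx /Ft scalerBl scale1r scalerBr opprD opprB addrCA subrKC
    addrC.
rewrite normrZ gtr0_norm//.
have : `|F x - c| <= 2 * (`|M + 1| + 1).
  apply: (le_trans (ler_normB _ _)).
  have := CM _ (FC _ Cx); have := CM _ Cc; have := ler_norm (M + 1); lra.
move=> /(ler_wpM2l (ltW t0)) /le_trans; apply.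
by rewrite -ler_pdivlMr ?ge_min ?lexx ?orbT// mulr_gt0// ltr_wpDl.
Qed.

End nonexpansive_maps_on_compact_sets.

(** * Boxes of linear combinations with bounded coefficients *)

Section boxes.
Context (R : realType) (V : normedModType R) (n : nat).
Variables (e : 'I_n -> V) (m : 'I_n -> R).

(** As the image of a product of segments under a linear map, it inherits compactness and convexity
    from the coefficients. *)
Definition box : set V :=
  [set \sum_i v ord0 i *: e i |
    v in [set v : 'rV[R]_n | forall i, `[- m i, m i]%classic (v ord0 i)]].

Lemma box_compact : compact box.
Proof.
apply: continuous_compact; last first.
  apply: (rV_compact (A := fun i => `[- m i, m i]%classic)) => i.
  exact: segment_compact.
apply: continuous_subspaceT; apply: continuous_big => [|i _ v].
  exact: add_continuous.
by apply: (@cvgZr_tmp _ _ _ _ (nbhs_filter v)); exact: coord_continuous.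
Qed.

Lemma box_convex : convex_set box.
Proof.
move=> _ _ t /set_mem[u um <-] /set_mem[v vm <-]; apply/mem_set.
exists (t%:num *: u + (1 - t%:num) *: v); last first.
  rewrite /conv/= !scaler_sumr -big_split/=; apply: eq_bigr => i _.
  by rewrite !mxE scalerDl !scalerA.
move=> i; have := um i; have := vm i; rewrite /= !in_itv/= !mxE.
have : 0 <= t%:num <= 1 by rewrite ge0 le1.
move: (t%:num) => a /andP[a0 a1] /andP[v1 v2] /andP[u1 u2].
have : 0 <= 1 - a by rewrite subr_ge0.
by move=> b0; apply/andP; split; nra.
Qed.

End boxes.

(** * Pointwise formulas and norm estimates in L1 *)

Section L1_estimates.
Context d (T : measurableType d) (R : realType).
Variable mu : {measure set T -> \bar R}.
Local Notation L1 := (LspaceType1 mu).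
Implicit Types f g : L1.

Lemma L1_addrE f g : (f + g : T -> R) = (fun x => f x + g x) %[ae mu].
Proof. exact: L1_addE. Qed.

Lemma L1_scalerE (a : R) f : (a *: f : T -> R) = (fun x => a * f x) %[ae mu].
Proof. exact: L1_scaleE. Qed.

Lemma L1_subrE f g : (f - g : T -> R) = (fun x => f x - g x) %[ae mu].
Proof.
rewrite -scaleN1r.
apply: filterS2 (L1_addrE f (-1 *: g)) (L1_scalerE (-1) g) => x fgE gE _.
by rewrite fgE// gE// mulN1r.
Qed.

Lemma L1_sumrE n (c : 'I_n -> R) (e : 'I_n -> L1) :
  ((\sum_i c i *: e i : L1) : T -> R) = (fun x => \sum_i c i * e i x) %[ae mu].
Proof.
elim: n c e => [|n IHn] c e.
  rewrite big_ord0; apply: filterS (L1_zeroE mu) => x zE _.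
  by rewrite big_ord0; exact: zE.
pose w := widen_ord (leqnSn n); pose u : L1 := \sum_i c (w i) *: e (w i).
have -> : \sum_i c i *: e i = u + c ord_max *: e ord_max.
  by rewrite big_ord_recr.
apply: filterS3 (IHn (c \o w) (e \o w)) (L1_scalerE (c ord_max) (e ord_max))
  (L1_addrE u (c ord_max *: e ord_max)).
by move=> x IH cE uE _; rewrite uE// cE// IH// big_ord_recr.
Qed.

Lemma L1_normBE f g : (`|f - g|)%:E = (\int[mu]_x `|f x - g x|%:E)%E.
Proof.
rewrite L1_normrE; apply: ae_eq_integral => //.
- apply: measurableT_comp => //; apply/measurable_EFinP.
  exact: L1_measurable.
- apply/measurable_EFinP; apply: measurableT_comp => //.
  by apply: measurable_funB; exact: L1_measurable.
by apply: filterS (L1_subrE f g) => x + _ => ->.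
Qed.

Lemma measurable_L1_dist f g :
  measurable_fun [set: T] (fun x => `|f x - g x|%:E).
Proof.
apply/measurable_EFinP; apply: measurableT_comp => //.
by apply: measurable_funB; exact: L1_measurable.
Qed.

Lemma L1_comp_nonexpansive (psi : R -> R) f1 f2 g1 g2 :
  1.-lipschitz psi ->
  (g1 : T -> R) = psi \o f1 %[ae mu] -> (g2 : T -> R) = psi \o f2 %[ae mu] ->
  `|g1 - g2| <= `|f1 - f2|.
Proof.
move=> lip g1E g2E; rewrite -lee_fin !L1_normBE.
apply: ae_ge0_le_integral => //; try exact: measurable_L1_dist.
apply: filterS2 g1E g2E => x -> // -> // _.
by have := lip (f1 x, f2 x) (conj I I); rewrite /self_sub/= mul1r lee_fin.
Qed.

(** On [B] the difference [g1 - g2] has constant sign, so the absolute value can be taken outside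
    the integral, where each [g] may be replaced by its [f]. *)
Lemma L1_integral_dist_le B f1 f2 g1 g2 : measurable B ->
  (\int[mu]_(x in B) (g1 x)%:E = \int[mu]_(x in B) (f1 x)%:E)%E ->
  (\int[mu]_(x in B) (g2 x)%:E = \int[mu]_(x in B) (f2 x)%:E)%E ->
  {ae mu, forall x, B x -> g2 x <= g1 x} ->
  (\int[mu]_(x in B) `|g1 x - g2 x|%:E <=
   \int[mu]_(x in B) `|f1 x - f2 x|%:E)%E.
Proof.
move=> mB fg1 fg2 g21.
have intB f : mu.-integrable B (EFin \o (f : T -> R)).
  by apply: integrableS (L1_integrable f).
have intBB f g : (\int[mu]_(x in B) (f x - g x)%:E =
    \int[mu]_(x in B) (f x)%:E - \int[mu]_(x in B) (g x)%:E)%E.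
  by rewrite -integralB_EFin.
have -> : (\int[mu]_(x in B) `|g1 x - g2 x|%:E =
           \int[mu]_(x in B) (g1 x - g2 x)%:E)%E.
  apply: ae_eq_integral => //.
  - by apply: measurable_funTS; exact: measurable_L1_dist.
  - apply/measurable_EFinP/measurable_funTS.
    by apply: measurable_funB; exact: L1_measurable.
  by apply: filterS g21 => x + Bx => /(_ Bx) gx; rewrite ger0_norm ?subr_ge0.
rewrite intBB fg1 fg2 -intBB; apply: le_trans (lee_abs _) _.
apply: le_abse_integral => //.
apply/measurable_EFinP/measurable_funTS.
by apply: measurable_funB; exact: L1_measurable.
Qed.

(** Cut the space according to the sign of [g1 - g2] and apply the preceding estimate on both
    pieces, with the roles exchanged on the second. *)
Lemma cond_exp_nonexpansive (G : set (set T)) f1 f2 g1 g2 :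
  sigma_algebra [set: T] G -> G `<=` measurable ->
  is_cond_exp G f1 g1 -> is_cond_exp G f2 g2 -> `|g1 - g2| <= `|f1 - f2|.
Proof.
move=> sG Gm [[h1 mh1 gh1] fg1] [[h2 mh2 gh2] fg2].
(* Comparing the [G]-measurable representatives puts [B] in [G], where the averaging identities
   hold. *)
pose B := [set x | h2 x <= h1 x].
have GB : G B.
  rewrite -(measurable_g_measurableTypeE sG).
  by have := measurable_fun_le measurableT mh2 mh1; rewrite setTI.
have GCB : G (~` B) by case: sG => _ /(_ _ GB); rewrite setTD.
have splitB f g : (`|f - g|)%:E = (\int[mu]_(x in B) `|f x - g x|%:E +
    \int[mu]_(x in ~` B) `|f x - g x|%:E)%E.
  rewrite L1_normBE -ge0_integral_setU ?setUv//.
  - exact: Gm.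
  - exact: Gm.
  - exact: measurable_L1_dist.
  - by apply/disj_setPCl.
rewrite -lee_fin !splitB; apply: leeD.
  apply: L1_integral_dist_le; [exact: Gm|exact: fg1|exact: fg2|].
  by apply: filterS2 gh1 gh2 => x -> // ->.
under eq_integral do rewrite distrC.
under [leRHS]eq_integral do rewrite distrC.
apply: L1_integral_dist_le; [exact: Gm|exact: fg2|exact: fg1|].
by apply: filterS2 gh1 gh2 => x -> // -> // /negP; rewrite -ltNge => /ltW.
Qed.

End L1_estimates.

(** * Atoms of a finite sigma-algebra *)

Section finite_sigma_algebra.
Context d (T : measurableType d) (R : realType).
Variable mu : {measure set T -> \bar R}.
Local Notation L1 := (LspaceType1 mu).
Variable G : set (set T).
Hypotheses (sG : sigma_algebra [set: T] G) (Gm : G `<=` measurable).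
Hypothesis finG : finite_set G.

(** Since [G] is finite, this intersection belongs to [G] and is its smallest member containing
    [x]. *)
Definition atom (x : T) : set T := \bigcap_(B in [set B | G B /\ B x]) B.

Lemma mem_atom x : atom x x. Proof. by move=> B []. Qed.

Lemma atom_sub x B : G B -> B x -> atom x `<=` B.
Proof. by move=> GB Bx y; apply. Qed.

Lemma G_atom x : G (atom x).
Proof.
rewrite -[X in X (atom x)](measurable_g_measurableTypeE sG).
apply: fin_bigcap_measurable => [|B [GB _]].
  by apply: sub_finite_set finG => B [].
by rewrite (measurable_g_measurableTypeE sG).
Qed.

(** If [x] were outside [atom y], the complement of [atom y] would be a member of [G] containing
    [x], hence all of [atom x], including [y]. *)
Lemma atom_eq x y : atom x y -> atom x = atom y.
Proof.
move=> xy; apply/seteqP; split; last exact: atom_sub (G_atom x) xy.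
have [yx|nyx] := pselect (atom y x); first exact: atom_sub (G_atom y) yx.
have GC : G (~` atom y) by case: sG => _ /(_ _ (G_atom y)); rewrite setTD.
by case: (atom_sub GC nyx xy); exact: mem_atom.
Qed.

Section measurable_for_G.
Variable h : T -> R.
Hypothesis mh : measurable_fun [set: g_sigma_algebraType G]
  (h : g_sigma_algebraType G -> R).

(** The level set of [h] through [x] is in [G], so it contains [atom x]. *)
Lemma atom_cst x y : atom x y -> h y = h x.
Proof.
move: y; apply: (@atom_sub x [set y | h y = h x]) => //.
rewrite -[X in X _](measurable_g_measurableTypeE sG).
by have := mh measurableT (measurable_set1 (h x)); rewrite setTI.
Qed.

(** The left side is the integral of the absolute value of [g] over the atom, as [h] is constant
    there. An atom of infinite measure thus forces [h x = 0]. *)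
Lemma atom_norm_le (g : L1) x : (g : T -> R) = h %[ae mu] ->
  (`|h x|%:E * mu (atom x) <= `|g|%:E)%E.
Proof.
move=> gh; have mA := Gm (G_atom x).
have mg : measurable_fun [set: T] (fun y => `|(g y)%:E|%E).
  apply: measurableT_comp => //; apply/measurable_EFinP.
  exact: L1_measurable.
rewrite -integral_cst// L1_normrE.
apply: (@le_trans _ _ (\int[mu]_(y in atom x) `|(g y)%:E|)%E); last first.
  exact: ge0_subset_integral.
rewrite le_eqVlt; apply/orP; left; apply/eqP.
apply: ae_eq_integral => //; first exact: measurable_funTS.
by apply: filterS gh => y gy Ay; rewrite gy// (atom_cst Ay).
Qed.

End measurable_for_G.

(** The default 0 makes this total, so that every member of [G] can serve as an index. *)
Definition L1_indic (B : set T) : L1 :=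
  if pselect (mu.-integrable [set: T] (EFin \o (\1_B : T -> R))) is left i
  then toL1 i else 0.

Lemma L1_indicE B : measurable B -> (mu B < +oo)%E ->
  (L1_indic B : T -> R) = \1_B %[ae mu].
Proof.
move=> mB Boo; rewrite /L1_indic; case: pselect => [i|[]]; first exact: toL1E.
apply/integrableP; split; first exact/measurable_EFinP.
rewrite (eq_integral (EFin \o \1_B)) ?integral_indic ?setIT// => x _ /=.
by rewrite ger0_norm.
Qed.

(* The coefficient of an atom [B] is bounded by [M / mu B]. All of [G] is used
   as index set; the junk value [M / fine (mu B) = M / 0 = 0] forces a zero
   coefficient when [mu B] is 0 or infinite, which is right since an integrable
   function vanishes on the atoms of infinite measure. *)
Lemma finite_sigma_algebra_box (M : R) :
  exists n (e : 'I_n -> L1) (m : 'I_n -> R), forall (g : L1) (h : T -> R),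
    `|g| <= M ->
    measurable_fun [set: g_sigma_algebraType G]
      (h : g_sigma_algebraType G -> R) ->
    (g : T -> R) = h %[ae mu] -> box e m g.
Proof.
have /finite_seqP[s0 Gs0] := finG.
(* Without repetitions each member of [G] has a single index, so each atom contributes a single
   term. *)
pose s := undup s0; have Gs B : G B = (B \in s) by rewrite Gs0 mem_undup.
pose B (i : 'I_(size s)) := nth set0 s i.
have GB i : G (B i) by rewrite Gs mem_nth.
exists (size s), (L1_indic \o B), (fun i => M / fine (mu (B i))).
move=> g h gM mh gh.
(* [fine] sends infinity to 0, so [P] selects the atoms of finite positive measure; [c] reads the
   constant value of [h] at a chosen point. *)
pose P A := (exists x, A = atom x) /\ fine (mu A) != 0.
pose c A := if `[< P A >] then h (xget point A) else 0.
have cE x : fine (mu (atom x)) != 0 -> c (atom x) = h x.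
  move=> A0; rewrite /c; case: asboolP => [_|[]]; last by split; [exists x|].
  by apply: (atom_cst mh); apply: xgetPex; exists x; exact: mem_atom.
have M0 : 0 <= M by exact: le_trans gM.
have hM x : (`|h x|%:E * mu (atom x) <= M%:E)%E.
  by apply: le_trans (atom_norm_le mh x gh) _; rewrite lee_fin.
exists (\row_i c (B i)).
  move=> i /=; rewrite in_itv/= -ler_norml mxE /c.
  case: asboolP => [[[x BE] B0]|_]; last first.
    by rewrite normr0 divr_ge0// fine_ge0.
  have Bx : B i x by rewrite BE; exact: mem_atom.
  have -> : h (xget point (B i)) = h x.
    apply: (atom_cst mh); rewrite -BE.
    by apply: (@xgetPex _ point (B i)); exists x.
  have B_gt0 : 0 < fine (mu (B i)) by rewrite lt_neqAle eq_sym B0 fine_ge0.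
  rewrite ler_pdivlMr// -lee_fin EFinM fineK ?BE ?hM// -BE.
  by move: B0; case: (mu (B i)) => //=; rewrite eqxx.
apply/L1_eqP.
have null_avoided : {ae mu, forall x, forall i, mu (B i) = 0 -> ~ B i x}.
  apply: filter_forall => i.
  have [B0|B0] := eqVneq (mu (B i)) 0; last first.
    by apply: aeW => x /eqP; rewrite (negPf B0).
  by exists (B i); split => //; [exact: Gm|move=> x /=; apply: contra_notP].
have eE : {ae mu, forall x, forall i, (mu (B i) < +oo)%E ->
    L1_indic (B i) x = \1_(B i) x}.
  apply: filter_forall => i.
  have [Boo|Boo] := pselect (mu (B i) < +oo)%E.
    by apply: filterS (L1_indicE (Gm (GB i)) Boo) => x + _; apply.
  by apply: aeW.
have sumE := L1_sumrE (fun i => c (B i)) (L1_indic \o B).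
under eq_bigr do rewrite mxE.
apply: filterS3 sumE eE (filterI null_avoided gh) => x sE xE [xN gx] _.
rewrite sE// gx//=.
have ax : atom x \in s by rewrite -Gs; exact: G_atom.
have ix : (index (atom x) s < size s)%N by rewrite index_mem.
have Bx : B (Ordinal ix) = atom x by rewrite /B nth_index.
(* Only the atom of [x] contributes: atoms that meet coincide. *)
rewrite (bigD1 (Ordinal ix))//= big1 ?addr0; last first.
  move=> i ine.
  rewrite /c; case: asboolP => [[[y By] B0]|_]; last by rewrite mul0r.
  have nBx : ~ B i x.
    rewrite By => /atom_eq; rewrite -By => BxE; move/eqP : ine; apply.
    apply: val_inj => /=; apply/eqP.
    by rewrite -(nth_uniq set0 (ltn_ord i) ix (undup_uniq s0)) -/(B i) BxE
      nth_index.
  rewrite xE; last first.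
    by rewrite ltey; move: B0; case: (mu (B i)) => //=; rewrite eqxx.
  by rewrite indicE memNset// mulr0.
have [A0|A0] := eqVneq (fine (mu (atom x))) 0; last first.
  have A1 : \1_(atom x) x = 1 :> R by rewrite indicE mem_set//; exact: mem_atom.
  rewrite Bx cE// -Bx xE ?Bx ?A1 ?mulr1//.
  by rewrite ltey; move: A0; case: (mu (atom x)) => //=; rewrite eqxx.
(* Here the atom has measure 0 or infinity. [xN] excludes the first, and in the second the bound
   [hM] forces [h x = 0]. *)
have -> : c (B (Ordinal ix)) = 0.
  by rewrite Bx /c; case: asboolP => // -[_]; rewrite A0 eqxx.
rewrite mul0r; apply/esym/eqP; apply: contraT => hx0.
have := hM x; have := xN (Ordinal ix); rewrite Bx.
have : (0 <= mu (atom x))%E by [].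
move: A0.
case: (mu (atom x)) => [r r0 _ nA|_ _ _|_]; last by rewrite leeNy_eq.
  by case: (nA (congr1 EFin r0)); exact: mem_atom.
by rewrite gt0_muley ?leye_eq// lte_fin normr_gt0.
Qed.

End finite_sigma_algebra.

(** * The fixed point of the composite *)

Theorem theorem2 (R : realType) (d : measure_display)
    (Omega : measurableType d)
    (mu : {sigma_finite_measure set Omega -> \bar R})
    (K : set (LspaceType1 mu)) (T H Q : {fun K >-> K})
    (psi : R -> R) (G : set (set Omega)) :
  K !=set0 ->
  bounded_set K ->
  closed K ->
  convex_set K ->
  measure_compact K ->
  1.-lipschitz_K T ->
  1.-lipschitz psi ->
  idempotent_fun psi ->
  (forall f, K f -> (H f : Omega -> R) = psi \o f %[ae mu]) ->
  sigma_algebra [set: Omega] G ->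
  G `<=` measurable ->
  finite_set G ->
  (forall f, K f -> is_cond_exp G f (Q f)) ->
  exists f : LspaceType1 mu,
    [/\ (Q @` K) f,
        (Q \o H \o T) f = f &
        forall n, iter n (Q \o H \o T) f = f].
Proof.
move=> [f0 Kf0] [M [_ KM]] clK cvxK _ lipT lippsi _ HE sG Gm finG QE.
have {}KM f : K f -> `|f| <= M + 1 by move=> /KM; apply; rewrite ltrDl.
have KT f : K f -> K (T f) by exact: funS.
have KH f : K f -> K (H f) by exact: funS.
have KQ f : K f -> K (Q f) by exact: funS.
have [n [e [m boxP]]] := finite_sigma_algebra_box mu sG Gm finG (M + 1).
(* The box gives norm compactness; the factor [K] keeps the hypotheses on the three maps
   available. *)
pose C := box e m `&` K.
have CQ f : K f -> C (Q f).
  move=> Kf; split; last exact: KQ.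
  have [[h mh Qh] _] := QE _ Kf.
  by apply: boxP mh Qh; exact/KM/KQ.
have [|||f Cf|f g [_ Kf] [_ Kg]|f [_ Kf] fixf] :=
    @compact_convex_nonexpansive_fixpoint R _ C _ _ (Q \o H \o T).
- by exists (Q f0); exact: CQ.
- by apply: compact_closedI clK; exact: box_compact.
- move=> f g t /set_mem[bf Kf] /set_mem[bg Kg]; apply/mem_set; split.
    by apply: set_mem; apply: box_convex; exact: mem_set.
  by apply: set_mem; apply: cvxK; exact: mem_set.
- by case: Cf => _ Kf; exact/CQ/KH/KT.
- apply: (le_trans (cond_exp_nonexpansive sG Gm (QE _ (KH _ (KT _ Kf)))
    (QE _ (KH _ (KT _ Kg))))).
  apply: (le_trans (L1_comp_nonexpansive lippsi (HE _ (KT _ Kf))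
    (HE _ (KT _ Kg)))).
  by have := lipT (f, g) (conj Kf Kg); rewrite /self_sub/= mul1r.
exists f; split => //; first by exists (H (T f)); [exact/KH/KT|exact: fixf].
by elim=> // k IHk; rewrite iterS IHk.
Qed.
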